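(* For any integer $n \geq 2$, the following hold: (1) For $G = (\mathbb{Z}/2\mathbb{Z})^{n} = \mathbb{Z}/2\mathbb{Z} \times (\mathbb{Z}/2\mathbb{Z})^{n-1}$, we have $S(G)_{\mathrm{even}} \subset 2^{2 \cdot 2^{n-1}}\, \mathbb{Z} = 2^{2^{n}}\, \mathbb{Z}$. (2) For $G = \mathbb{Z}/2^{n}\mathbb{Z} \times \mathbb{Z}/2\mathbb{Z}$, we have $S(G)_{\mathrm{even}} \subset 2^{2(n+2)}\, \mathbb{Z}$.
   Context: For a finite group $G$, let $S(G) := \{ \det( x_{gh^{-1}} )_{g,h \in G} \mid x_g \in \mathbb{Z} \text{ for all } g \in G \}$ be the set of values of integer group determinants of $G$ (the matrix has rows and columns indexed by $G$, with $(g,h)$ entry $x_{gh^{-1}}$), and let $S(G)_{\mathrm{even}} := S(G) \cap 2\mathbb{Z}$. The symbol $\subset$ denotes (not necessarily strict) inclusion. *)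

(* Defs.v *)
From mathcomp Require Import all_boot all_order all_fingroup all_algebra.
From mathcomp Require Import classical_sets.

Set Implicit Arguments.
Unset Strict Implicit.
Unset Printing Implicit Defensive.

Import GRing.Theory.
Local Open Scope ring_scope.
Local Open Scope classical_set_scope.

(* The rows and columns are indexed by G through [enum_val]; the determinant
   does not depend on the enumeration, since it is used on both sides. *)
Definition group_matrix (gT : finGroupType) (x : gT -> int) : 'M[int]_#|gT| :=
  \matrix_(i, j) x (enum_val i * (enum_val j)^-1)%g.

Definition group_det (gT : finGroupType) (x : gT -> int) : int :=
  \det (group_matrix x).

Definition det_values (gT : finGroupType) : set int :=
  [set group_det x | x in [set: gT -> int]].

Definition multiples (d : int) : set int := [set d * k | k in [set: int]].

Definition det_values_even (gT : finGroupType) : set int :=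
  det_values gT `&` multiples 2.

(* Main.v *)
Require Import Defs.
From mathcomp Require Import all_boot all_order all_fingroup all_algebra.
From mathcomp Require Import classical_sets.
From mathcomp Require Import ring zify.

(** Let G be a finite group with a central element z of order 2, and let
    H = G / {1, z}.  Listing G as a transversal of H followed by its translate
    by z gives the group matrix of G the block form [[A, B], [B, A]], whose
    determinant is det (A + B) * det (A - B).  The matrix A + B is the group
    matrix of H for the function obtained from x by summing over the fibres of
    G -> H ([group_det_double_cover]).  The two factors are congruent modulo 2,
    since A + B and A - B are; so when the product is even, both factors are
    even ([even_group_det_double_cover]).

    When the quotient map splits, G = H x Z/2, the matrix A - B is also a group
    matrix of H.  A divisor c of all even group determinants of H then yields
    the divisor c^2 for G ([even_group_det_split]).  Starting from the trivial
    group and iterating, the even determinants of (Z/2)^n are multiples of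
    2^(2^n).

    For the cyclic group of order 2^(n+1), a double cover of the cyclic group
    of order 2^n, A - B is only a skew-circulant matrix, so that its determinant
    contributes a single factor 2.  The exponent n + 2 for Z/2^n thus follows by
    induction from n = 2, where the four-variable polynomial
    ((x0+x2)^2 - (x1+x3)^2) ((x0-x2)^2 + (x1-x3)^2) is shown to be divisible by
    16 as soon as it is even ([even_Z4_arith]).  The split case then doubles the
    exponent for Z/2^n x Z/2. *)

Set Implicit Arguments.
Unset Strict Implicit.
Unset Printing Implicit Defensive.

Import GRing.Theory.
Local Open Scope ring_scope.
Local Open Scope classical_set_scope.

(** * Determinants indexed by a finite type *)

Definition det_on (T : finType) (F : T -> T -> int) : int :=
  \det (\matrix_(i < #|T|, j < #|T|) F (enum_val i) (enum_val j)).

Lemma group_detE (gT : finGroupType) (x : gT -> int) :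
  group_det x = det_on (fun g h => x (g * h^-1)%g).
Proof. by []. Qed.

Lemma eq_det_on (T : finType) (F F' : T -> T -> int) :
  (forall a b, F a b = F' a b) -> det_on F = det_on F'.
Proof. by move=> eF; congr (\det _); apply/matrixP=> i j; rewrite !mxE. Qed.

(** Changing the enumeration conjugates the matrix by a permutation matrix, and
    the two signs cancel. *)
Lemma det_on_bij (T : finType) (F : T -> T -> int) (m : nat) (e : 'I_m -> T) :
  bijective e -> det_on F = \det (\matrix_(i, j) F (e i) (e j)).
Proof.
move=> bij_e; have m_eq : m = #|T| by rewrite -(bij_eq_card bij_e) card_ord.
subst m; have inj_r : injective (enum_rank \o e).
  exact: inj_comp enum_rank_inj (bij_inj bij_e).
set A := (\matrix_(i < #|T|, j < #|T|) F (enum_val i) (enum_val j)).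
pose r := perm inj_r.
have -> : \matrix_(i, j) F (e i) (e j) = row_perm r (col_perm r A).
  by apply/matrixP=> i j; rewrite !mxE !permE /= !enum_rankK.
rewrite row_permE col_permE !det_mulmx !det_perm mulrCA mulrA -mulrA.
by rewrite odd_permV -signr_addb addbb mulr1.
Qed.

(** Adding the second block row to the first one, then subtracting the first
    block column from the second one, makes the matrix block triangular. *)
Lemma det_block_swap (R : comPzRingType) (m : nat) (A B : 'M[R]_m) :
  \det (block_mx A B B A) = \det (A + B) * \det (A - B).
Proof.
have triangular : block_mx 1%:M 1%:M 0 1%:M *m block_mx A B B A
    *m block_mx 1%:M (- 1%:M) 0 1%:M = block_mx (A + B) 0 B (A - B).
  rewrite !mulmx_block !mul1mx !mul0mx !mulmx0 !mulmxN !mulmx1 !add0r !addr0.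
  by rewrite [B + A]addrC addNr [- B + A]addrC.
have := congr1 determinant triangular.
by rewrite !det_mulmx !det_ublock det_lblock !det1 !mul1r !mulr1.
Qed.

(** Over 'F_2 the two matrices are equal. *)
Lemma det_on_eqmod2 (T : finType) (u v : T -> T -> int) :
  (2 %| det_on (fun a b => (u a b + v a b)%R))%Z
  = (2 %| det_on (fun a b => (u a b - v a b)%R))%Z.
Proof.
rewrite !(@dvdz_pcharf 'F_2 2) // /det_on -!(det_map_mx (intmul 1)).
congr (\det _ == 0); apply/matrixP=> i j; rewrite !mxE rmorphD rmorphB /=.
by rewrite [- _]oppr_pchar2.
Qed.

(** * Central extensions by a group of order two *)

(** The exact sequence 1 -> {1, z} -> gT -> hT -> 1 with z central, together
    with a set-theoretic section s of p, that is, a transversal of {1, z}. *)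
Record double_cover (gT hT : finGroupType)
    (p : gT -> hT) (s : hT -> gT) (z : gT) : Prop := DoubleCover {
  dc_morph : {morph p : a b / (a * b)%g};
  dc_section : cancel s p;
  dc_ker : forall a, p a = 1%g -> a = 1%g \/ a = z;
  dc_z : p z = 1%g;
  dc_z_neq1 : z <> 1%g;
  dc_central : forall a, commute z a
}.

Section DoubleCover.

Variables (gT hT : finGroupType) (p : gT -> hT) (s : hT -> gT) (z : gT).
Hypothesis dc : double_cover p s z.
Local Open Scope group_scope.

Let pM := dc_morph dc.
Let sK := dc_section dc.
Let pz := dc_z dc.
Let zC := dc_central dc.

Let p1 : p 1 = 1.
Proof. by apply: (mulgI (p 1)); rewrite -pM !mulg1. Qed.

Let pV a : p a^-1 = (p a)^-1.
Proof. by apply: (mulgI (p a)); rewrite -pM !mulgV p1. Qed.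

Lemma dc_fibre a b : p a = p b -> a = b \/ a = z * b.
Proof.
move=> eq_p; have : p (a * b^-1) = 1 by rewrite pM pV eq_p mulgV.
case/(dc_ker dc) => eq_ab; [left | right].
  by rewrite -[a](mulgKV b) eq_ab mul1g.
by rewrite -[a](mulgKV b) eq_ab.
Qed.

Let zz : z * z = 1.
Proof.
have : p (z * z) = 1 by rewrite pM pz mulg1.
case/(dc_ker dc) => // /eqP.
by rewrite -[X in _ == X]mulg1 (inj_eq (mulgI z)) => /eqP /(dc_z_neq1 dc).
Qed.

Let zV : z^-1 = z.
Proof. by apply: (mulgI z); rewrite mulgV zz. Qed.

(* The enumeration of gT by a transversal followed by its translate by z. *)
Let e (k : 'I_(#|hT| + #|hT|)) : gT :=
  match fintype.split k with
  | inl i => s (enum_val i)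
  | inr i => z * s (enum_val i)
  end.

Let e_bij : bijective e.
Proof.
exists (fun a => if a == s (p a) then lshift #|hT| (enum_rank (p a))
                 else rshift #|hT| (enum_rank (p a))).
  move=> k; rewrite /e -[RHS]splitK; case: fintype.split => i /=.
    by rewrite sK eqxx enum_valK.
  rewrite pM pz mul1g sK enum_valK.
  case: eqP => // /(canRL (mulgK _)); rewrite mulgV.
  by move/(dc_z_neq1 dc).
move=> a; rewrite /e; case: eqP => [eq_a | neq_a].
  by rewrite (unsplitK (inl _)) enum_rankK -eq_a.
rewrite (unsplitK (inr _)) enum_rankK.
by case: (@dc_fibre a (s (p a))) => //; rewrite sK.
Qed.

(** The sum of x over a fibre of p does not depend on the chosen
    representative, so s (h * k^-1) may be replaced by s h * (s k)^-1, which lies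
    in the same fibre. *)
Lemma group_det_push (x : gT -> int) :
  group_det (fun h => x (s h) + x (z * s h)%g)%R =
  det_on (fun h k => x (s h * (s k)^-1)%g + x (z * (s h * (s k)^-1))%g)%R.
Proof.
rewrite group_detE; apply: eq_det_on => h k.
case: (@dc_fibre (s h * (s k)^-1) (s (h * k^-1))) => [|->|->] //.
  by rewrite pM pV !sK.
by rewrite mulgA zz mul1g addrC.
Qed.

(** In the enumeration of gT by a transversal and its translate by z, the group
    matrix has equal diagonal blocks because z is central, and equal off-diagonal
    blocks because moreover z is its own inverse. *)
Lemma group_det_double_cover (x : gT -> int) :
  group_det x =
    (group_det (fun h => x (s h) + x (z * s h)%g) *
     det_on (fun h k => x (s h * (s k)^-1)%g - x (z * (s h * (s k)^-1))%g))%R.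
Proof.
rewrite group_det_push group_detE (det_on_bij _ e_bij).
pose A := (\matrix_(i < #|hT|, j < #|hT|) x (s (enum_val i) * (s (enum_val j))^-1)%g)%R.
pose B := (\matrix_(i < #|hT|, j < #|hT|) x (z * (s (enum_val i) * (s (enum_val j))^-1))%g)%R.
transitivity (\det (block_mx A B B A))%R; last first.
  rewrite det_block_swap /det_on.
  by congr (_ * _)%R; congr (\det _)%R; apply/matrixP=> i j; rewrite !mxE.
congr (\det _)%R; rewrite -[LHS]submxK.
congr block_mx; apply/matrixP=> i j; rewrite !mxE /e.
- by rewrite !(unsplitK (inl _)).
- rewrite (unsplitK (inl _)) (unsplitK (inr _)) invMg zV mulgA.
  by rewrite -(zC (_ * _)).
- by rewrite (unsplitK (inl _)) (unsplitK (inr _)) mulgA.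
by rewrite !(unsplitK (inr _)) invMg zV (zC (s _)) -(zC (_^-1)) -mulgA (mulgA z) zz mul1g.
Qed.

(** The two factors have the same parity, and their product is even. *)
Lemma even_group_det_double_cover (x : gT -> int) :
  (2 %| group_det x)%Z ->
  (2 %| group_det (fun h => x (s h) + x (z * s h)%g)%R)%Z /\
  (2 %| det_on (fun h k => x (s h * (s k)^-1)%g - x (z * (s h * (s k)^-1))%g)%R)%Z.
Proof.
rewrite group_det_double_cover group_det_push -det_on_eqmod2.
by rewrite dvdzE abszM Euclid_dvdM // -!dvdzE -det_on_eqmod2 orbb.
Qed.

(** When s is a morphism, the second factor is the group determinant of hT at
    h |-> x (s h) - x (z * s h), so the divisibility known for hT applies to both
    factors. *)
Lemma even_group_det_split (c : int) (x : gT -> int) :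
    {morph s : h k / h * k} ->
    (forall y : hT -> int, (2 %| group_det y)%Z -> (c %| group_det y)%Z) ->
  (2 %| group_det x)%Z -> (c ^+ 2 %| group_det x)%Z.
Proof.
move=> sM even_c /even_group_det_double_cover[even_y even_d].
have s1 : s 1 = 1 by apply: (mulgI (s 1)); rewrite -sM !mulg1.
have sV h : s h^-1 = (s h)^-1 by apply: (mulgI (s h)); rewrite -sM !mulgV s1.
rewrite group_det_double_cover expr2 dvdz_mul ?even_c //.
have eq_d : group_det (fun h => x (s h) - x (z * s h)%g)%R =
    det_on (fun h k => x (s h * (s k)^-1)%g - x (z * (s h * (s k)^-1))%g)%R.
  by rewrite group_detE; apply: eq_det_on => h k; rewrite sM sV.
by rewrite -eq_d even_c // eq_d.
Qed.

End DoubleCover.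

(** * The double covers used for elementary abelian and cyclic groups *)

Lemma dc_prod (gT : finGroupType) :
  @double_cover (gT * 'Z_2)%type gT fst (fun h => (h, 1%g)) (1%g, 1%R).
Proof.
split=> //.
- move=> [a b] /= ->.
  by case: b => [[|[|//]] b_lt]; [left | right]; congr pair; apply: val_inj.
- by move=> [a b]; congr pair; rewrite /= ?mulg1 ?mul1g //; apply: addrC.
Qed.

Lemma dc_rV (n : nat) :
  @double_cover 'rV['Z_2]_(1 + n) 'rV['Z_2]_n rsubmx (row_mx 0)
    (row_mx (const_mx 1) 0).
Proof.
split.
- by move=> a b; apply: linearD.
- by move=> a; rewrite row_mxKr.
- move=> a a0; rewrite -[a]hsubmxK [rsubmx a]a0.
  case: (lsubmx a 0 0) (mx11_scalar (lsubmx a)) => [[|[|//]] lt_i] ->; [left|right].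
    rewrite (_ : Ordinal lt_i = 0); last exact: val_inj.
    by rewrite raddf0 row_mx0.
  by congr row_mx; apply/matrixP=> i j; rewrite !ord1 !mxE; apply: val_inj.
- by rewrite row_mxKr.
- by move/matrixP/(_ 0 (lshift n 0)); rewrite row_mxEl !mxE.
- by move=> a; apply: addrC.
Qed.

(** Reduction modulo m.+2; the bounds k.+2 and m.+2 make both ordinal types
    groups without any cast. *)
Lemma dc_ord (k m : nat) :
  k.+2 = (2 * m.+2)%N ->
  @double_cover 'I_k.+2 'I_m.+2 (fun a => inZp a) (fun a => inZp a) (inZp m.+2).
Proof.
move=> k_eq; have dvd_mk : (m.+2 %| k.+2)%N by rewrite k_eq dvdn_mull.
have lt_mk : (m.+2 < k.+2)%N by lia.
split.
- by move=> a b; apply: val_inj; rewrite /= modn_dvdm // modnDm.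
- by move=> a; apply: val_inj; rewrite /= modn_dvdm // modn_small.
- move=> a /(congr1 val) /= a_mod.
  have := ltn_ord a; have := divn_eq a m.+2; rewrite a_mod addn0.
  case: (a %/ _)%N => [|[|q]] eq_a lt_a; last by lia.
    by left; apply: val_inj; rewrite /= eq_a.
  by right; apply: val_inj; rewrite /= eq_a mul1n modn_small.
- by apply: val_inj; rewrite /= modn_dvdm // modnn.
- by move/(congr1 val); rewrite /= modn_small.
- by move=> a; apply: addrC.
Qed.

Lemma dc_Zp (n : nat) :
  @double_cover 'Z_(2 ^ n.+2) 'Z_(2 ^ n.+1) (fun a => inZp a) (fun a => inZp a)
    (inZp (Zp_trunc (2 ^ n.+1)).+2).
Proof.
have p_gt0 : (0 < 2 ^ n)%N by rewrite expn_gt0.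
by apply: dc_ord; rewrite !Zp_cast ?expnS //; lia.
Qed.

(** * Elementary abelian 2-groups *)

(** For n = 0 the bound 2^(2^0) is 2 itself; each further coordinate squares the
    bound. *)
Lemma even_group_det_rV (n : nat) (x : 'rV['Z_2]_n -> int) :
  (2 %| group_det x)%Z -> (2 ^+ (2 ^ n) %| group_det x)%Z.
Proof.
elim: n x => [|n IHn] x //.
rewrite expnSr exprM; apply: (even_group_det_split (dc_rV n)) => //.
by move=> h k; rewrite /= [RHS]add_row_mx addr0.
Qed.

(** * Cyclic 2-groups *)

Lemma det_mx22 (R : comPzRingType) (A : 'M[R]_2) :
  \det A = A 0 0 * A 1 1 - A 0 1 * A 1 0.
Proof.
rewrite (expand_det_row A 0) !big_ord_recl big_ord0 addr0 /cofactor !det_mx11 !mxE.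
have -> : lift 0 0 = 1 :> 'I_2 by apply: val_inj.
have -> : lift 1 0 = 0 :> 'I_2 by apply: val_inj.
by rewrite expr0 expr1 mul1r mulN1r mulrN.
Qed.

Lemma group_det_Z4 (x : 'Z_(2 ^ 2) -> int) :
  exists x0 x1 x2 x3 : int, group_det x =
    ((x0 + x2) ^+ 2 - (x1 + x3) ^+ 2) * ((x0 - x2) ^+ 2 + (x1 - x3) ^+ 2).
Proof.
(* Reading x through the representatives in nat lets all its arguments reduce
   to numerals by conversion. *)
have [X xE] : exists X : nat -> int, forall g, x g = X (val g).
  by exists (fun k => x (inZp k)) => g; rewrite valZpK.
exists (X 0%N), (X 1%N), (X 2), (X 3).
have bij_id : bijective (id : 'I_2 -> 'Z_(2 ^ 1)) by exists id.
rewrite (group_det_double_cover (dc_Zp 0)) group_detE.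
rewrite !(det_on_bij _ bij_id) !det_mx22 !mxE !xE.
(* Z/4 is treated as a double cover of Z/2: the second factor is the
   skew-circulant determinant of (x0 - x2, x1 - x3). *)
change (((X 0 + X 2) * (X 0 + X 2) - (X 1 + X 3) * (X 1 + X 3)) *
  ((X 0 - X 2) * (X 0 - X 2) - (X 3 - X 1) * (X 1 - X 3)) =
  ((X 0 + X 2) ^+ 2 - (X 1 + X 3) ^+ 2) * ((X 0 - X 2) ^+ 2 + (X 1 - X 3) ^+ 2)).
by ring.
Qed.

Lemma parity (k : int) : exists q : int, k = 2 * q \/ k = 2 * q + 1.
Proof. by exists (k %/ 2)%Z; lia. Qed.

(** Put t = (x0+x2) - (x1+x3).  The form is congruent to t^4 modulo 2, so t is
    even and 4 divides the difference of squares.  If x1 + x3 is even, so are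
    x0 - x2 and x1 - x3, and the sum of squares is divisible by 4.  If x1 + x3
    is odd, all four sums and differences are odd: the difference of squares is
    divisible by 8 and the sum of squares by 2. *)
Lemma even_Z4_arith (x0 x1 x2 x3 : int) :
  (2 %| ((x0 + x2) ^+ 2 - (x1 + x3) ^+ 2) * ((x0 - x2) ^+ 2 + (x1 - x3) ^+ 2))%Z ->
  (2 ^+ 4 %| ((x0 + x2) ^+ 2 - (x1 + x3) ^+ 2) *
             ((x0 - x2) ^+ 2 + (x1 - x3) ^+ 2))%Z.
Proof.
set f := (_ * _); move=> even_f; pose b := x1 + x3; pose t := x0 + x2 - b.
have /dvdzP[m t_eq] : (2 %| t)%Z.
  have : (2 %| t ^+ 4)%Z.
    (* With S the sum of squares, f = t^2 S + 2 b t S, and S = t^2 mod 2. *)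
    have -> : t ^+ 4 = f - (b * t * ((x0 - x2) ^+ 2 + (x1 - x3) ^+ 2) +
        t ^+ 2 * ((x0 - x2) * (x1 - x3) + 2 * (x0 - x2 - x1 + x3) * (x3 - x2)
        - 2 * (x2 - x3) ^+ 2)) * 2.
      by rewrite /f /t /b; ring.
    by rewrite rpredB // dvdz_mull.
  by rewrite !dvdzE abszX Euclid_dvdX // andbT.
have [r b_eq] := parity b.
have x0_eq : x0 = 2 * m + b - x2 by rewrite /t in t_eq; lia.
have x1_eq : x1 = b - x3 by rewrite /b; lia.
rewrite {even_f}/f x0_eq x1_eq.
case: b_eq => ->.
  apply/dvdzP; exists (m * (m + 2 * r) * ((m + r - x2) ^+ 2 + (r - x3) ^+ 2)).
  by ring.
have [q [->|->]] := parity m; apply/dvdzP.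
  exists (q * (2 * q + 2 * r + 1) *
    (2 * ((2 * q + r - x2) ^+ 2 + (2 * q + r - x2) + (r - x3) ^+ 2 + (r - x3)) + 1)).
  by ring.
exists ((2 * q + 1) * (q + r + 1) *
  (2 * ((2 * q + 1 + r - x2) ^+ 2 + (2 * q + 1 + r - x2)
  + (r - x3) ^+ 2 + (r - x3)) + 1)).
by ring.
Qed.

(** Each doubling of the order from Z/4 on adds one factor 2, coming from the
    skew-circulant determinant. *)
Lemma even_group_det_Zp (n : nat) (x : 'Z_(2 ^ n) -> int) :
  (2 <= n)%N -> (2 %| group_det x)%Z -> (2 ^+ (n + 2) %| group_det x)%Z.
Proof.
case: n x => [|[|n]] // x _; elim: n x => [|n IHn] x.
  have [x0 [x1 [x2 [x3 ->]]]] := group_det_Z4 x; exact: even_Z4_arith.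
move=> /(even_group_det_double_cover (dc_Zp n.+1))[even_y even_d].
by rewrite (group_det_double_cover (dc_Zp n.+1)) addSn exprSr dvdz_mul // IHn.
Qed.

(** * Conclusion *)

Lemma isog_rV (n : nat) :
  [set: 'rV['Z_2]_n.+1]%SET \isog [set: ('Z_2 * 'rV['Z_2]_n)%type]%SET.
Proof.
pose f (v : 'rV['Z_2]_(1 + n)) : ('Z_2 * 'rV['Z_2]_n)%type := (lsubmx v 0 0, rsubmx v).
have fM : {in [set: 'rV['Z_2]_n.+1]%SET &, {morph f : u v / (u * v)%g}}.
  move=> u v _ _; congr pair; first by rewrite /= !mxE.
  exact: (dc_morph (dc_rV n)).
apply/isogP; exists (Morphism fM).
  apply/injmP => u v _ _ [eq_l eq_r].
  move: (u : 'rV_(1 + n)) (v : 'rV_(1 + n)) eq_l eq_r => u1 v1 eq_l eq_r.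
  rewrite -[u1]hsubmxK -[v1]hsubmxK eq_r.
  by rewrite [lsubmx u1]mx11_scalar eq_l -mx11_scalar.
apply/setP => -[a v]; rewrite inE; apply/morphimP.
exists (row_mx a%:M v); rewrite ?inE // /= /f row_mxKl row_mxKr.
by rewrite mxE eqxx.
Qed.

Lemma multiplesP (d m : int) : multiples d m <-> (d %| m)%Z.
Proof.
split=> [[k _ <-] | /dvdzP[k ->]]; first exact: dvdz_mulr.
by exists k => //; rewrite mulrC.
Qed.

Theorem corollary3 (n : nat) (hn : (2 <= n)%N) :
  [/\ [set: 'rV['Z_2]_n]%SET \isog [set: ('Z_2 * 'rV['Z_2]_n.-1)%type]%SET,
      det_values_even 'rV['Z_2]_n `<=` multiples (2 ^+ (2 * 2 ^ n.-1)),
      multiples (2 ^+ (2 * 2 ^ n.-1)) = multiples (2 ^+ (2 ^ n))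
    & det_values_even ('Z_(2 ^ n) * 'Z_2)%type `<=`
      multiples (2 ^+ (2 * (n + 2)))].
Proof.
have exp_eq : (2 * 2 ^ n.-1 = 2 ^ n)%N by rewrite -expnS prednK //; lia.
split.
- by case: n hn {exp_eq} => // n _; apply: isog_rV.
- move=> _ [[x _ <-] /multiplesP even_x]; apply/multiplesP.
  by rewrite exp_eq; apply: even_group_det_rV.
- by rewrite exp_eq.
move=> _ [[x _ <-] /multiplesP even_x]; apply/multiplesP.
rewrite mulnC exprM; apply: (even_group_det_split (dc_prod 'Z_(2 ^ n))) => //.
  by move=> h k; congr pair; rewrite mulg1.
by move=> y; apply: even_group_det_Zp.
Qed.
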